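(* Let $n\ge 3$ be an integer, $0<r<1$, and let $s,h\in\mathbb{R}$ satisfy $s>0$, $s\ne r$, $h\neq 0$. Put $$x=\frac{s+(r-s)\cos\frac{2\pi}{n}}{\cos\frac{\pi}{n}},\qquad z=\frac{h}{r-s}\Big(r-x\cos\tfrac{\pi}{n}\Big),$$ and assume $x>0$. Consider the quadratic triangular Bézier patch with control points $$\boldsymbol{b}_{2,0,0}=(0,0,\sqrt{1-r^2}+h),\quad \boldsymbol{b}_{0,2,0}=\big(r\cos\tfrac{\pi}{n},-r\sin\tfrac{\pi}{n},\sqrt{1-r^2}\big),\quad \boldsymbol{b}_{0,0,2}=\big(r\cos\tfrac{\pi}{n},r\sin\tfrac{\pi}{n},\sqrt{1-r^2}\big),$$ $$\boldsymbol{b}_{0,1,1}=(x,0,\sqrt{1-r^2}+z),\quad \boldsymbol{b}_{1,1,0}=\big(s\cos\tfrac{\pi}{n},-s\sin\tfrac{\pi}{n},\sqrt{1-r^2}+h\big),\quad \boldsymbol{b}_{1,0,1}=\big(s\cos\tfrac{\pi}{n},s\sin\tfrac{\pi}{n},\sqrt{1-r^2}+h\big).$$ Then the spline consisting of the $n$ patches obtained from this patch by the rotations about the $z$-axis through the angles $\frac{2\pi k}{n}$, $k=0,\dots,n-1$, is $G^1$ continuous.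
   Context: Let $\Delta=\{(\xi,\eta)\in\mathbb{R}^2: \xi,\eta\ge 0,\ \xi+\eta\le 1\}$. The quadratic triangular Bézier patch with control points $\boldsymbol{b}_{i,j,k}\in\mathbb{R}^3$, $i+j+k=2$, $i,j,k\ge0$, is the map $\boldsymbol{p}:\Delta\to\mathbb{R}^3$, $\boldsymbol{p}(\xi,\eta)=\sum_{i+j+k=2}\frac{2}{i!\,j!\,k!}\xi^i\eta^j(1-\xi-\eta)^k\boldsymbol{b}_{i,j,k}$. Consecutive rotated patches share a boundary curve (for the patch above and its rotation by $\frac{2\pi}{n}$ it is the quadratic Bézier curve with control points $\boldsymbol{b}_{0,0,2},\boldsymbol{b}_{1,0,1},\boldsymbol{b}_{2,0,0}$). The spline is $G^1$ continuous if for any two patches sharing a boundary curve the tangent planes coincide along this curve, i.e. at each of its points the tangent vector of the curve and the cross-boundary first partial derivatives of the two patches are coplanar. *)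

(* Defs.v *)
From HB Require Import structures.
From mathcomp Require Import all_boot all_order all_algebra.
From mathcomp Require Import all_classical all_reals all_analysis.

Set Implicit Arguments.
Unset Strict Implicit.
Unset Printing Implicit Defensive.

Import Order.TTheory GRing.Theory Num.Theory.
Import numFieldNormedType.Exports.

Local Open Scope classical_set_scope.
Local Open Scope ring_scope.

Section Patches.
Variable R : realType.

Definition vec3 (a b c : R) : 'rV[R]_3 := \row_(i < 3) [:: a; b; c]`_i.

Definition rotz (theta : R) (v : 'rV[R]_3) : 'rV[R]_3 :=
  let x := v 0 0 in let y := v 0 1 in let z := v 0 2%:R in
  vec3 (cos theta * x - sin theta * y) (sin theta * x + cos theta * y) z.

(* A patch is a map of the parameters (xi, eta). It is defined on the whole
   plane, so that derivatives at the boundary of the parameter triangle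
   xi, eta >= 0, xi + eta <= 1 are ordinary derivatives; for polynomial patches
   they agree with the one-sided derivatives from within the triangle. *)
Definition patch : Type := R -> R -> 'rV[R]_3.

Definition bezier2 (b : nat -> nat -> nat -> 'rV[R]_3) : patch :=
  fun xi eta =>
    \sum_(i < 3) \sum_(j < 3) \sum_(k < 3 | (i + j + k == 2)%N)
      (2 / (i`! * j`! * k`!)%:R * xi ^+ i * eta ^+ j * (1 - xi - eta) ^+ k)
        *: b i j k.

Definition partial_xi (p : patch) (xi eta : R) : 'rV[R]_3 :=
  derive1 (fun u => p u eta) xi.

Definition partial_eta (p : patch) (xi eta : R) : 'rV[R]_3 :=
  derive1 (fun u => p xi u) eta.

(* The three sides xi = 0, eta = 0 and xi + eta = 1 of the parameter triangle. *)
Inductive side : Set := side_xi0 | side_eta0 | side_diag.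

Definition side_pt (e : side) (t : R) : R * R :=
  match e with
  | side_xi0 => (0, t)
  | side_eta0 => (t, 0)
  | side_diag => (t, 1 - t)
  end.

Definition boundary_curve (p : patch) (e : side) (t : R) : 'rV[R]_3 :=
  p (side_pt e t).1 (side_pt e t).2.

Definition boundary_tangent (p : patch) (e : side) (t : R) : 'rV[R]_3 :=
  derive1 (boundary_curve p e) t.

(* On the side xi + eta = 1 both partial derivatives are transversal; their
   difference is the tangent vector of the boundary curve, so either choice
   spans the same space together with that tangent vector. *)
Definition cross_partial (p : patch) (e : side) (t : R) : 'rV[R]_3 :=
  match e with
  | side_xi0 => partial_xi p (side_pt e t).1 (side_pt e t).2
  | side_eta0 => partial_eta p (side_pt e t).1 (side_pt e t).2
  | side_diag => partial_xi p (side_pt e t).1 (side_pt e t).2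
  end.

Definition boundary_set (p : patch) (e : side) : set 'rV[R]_3 :=
  boundary_curve p e @` `[0, 1].

Definition coplanar (u v w : 'rV[R]_3) : Prop := (\rank (u + v + w)%MS <= 2)%N.

(* The parameters t and t' of a common point may differ, since the two patches
   may traverse the shared curve differently. *)
Definition G1_along (p q : patch) (e f : side) : Prop :=
  forall t t' : R, t \in `[0, 1] -> t' \in `[0, 1] ->
    boundary_curve p e t = boundary_curve q f t' ->
    coplanar (boundary_tangent p e t) (cross_partial p e t)
             (cross_partial q f t').

Definition G1_continuous (n : nat) (P : 'I_n -> patch) : Prop :=
  forall (k l : 'I_n) (e f : side), k != l ->
    boundary_set (P k) e = boundary_set (P l) f -> G1_along (P k) (P l) e f.

Definition control_point (n : nat) (r s h x z : R) (i j k : nat) : 'rV[R]_3 :=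
  let a : R := pi / n%:R in
  let c : R := Num.sqrt (1 - r ^+ 2) in
  match i, j, k with
  | 2, 0, 0 => vec3 0 0 (c + h)
  | 0, 2, 0 => vec3 (r * cos a) (- (r * sin a)) c
  | 0, 0, 2 => vec3 (r * cos a) (r * sin a) c
  | 0, 1, 1 => vec3 x 0 (c + z)
  | 1, 1, 0 => vec3 (s * cos a) (- (s * sin a)) (c + h)
  | 1, 0, 1 => vec3 (s * cos a) (s * sin a) (c + h)
  | _, _, _ => 0
  end.

Definition rotated_patches (n : nat) (p : patch) (k : 'I_n) : patch :=
  fun xi eta => rotz (2 * pi * k%:R / n%:R) (p xi eta).

End Patches.

(* Main.v *)
(* Along the common edge of two neighbouring patches, the cross-boundary
   derivative of the second is that of the first plus [2 cos (2 pi / n) - 1]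
   times the tangent of the edge: the choice of [x] and [z] is exactly what
   makes this hold on the Bernstein coefficients.
   All other pairs of sides are distinct curves: an outer side ([xi = 0])
   misses the axis and stays in the angular sector of its patch, while an inner
   side is an arc in a meridian half-plane, from the axis to its base point, so
   two inner sides agree only if their half-planes do. *)
Require Import Defs.
From HB Require Import structures.
From mathcomp Require Import all_boot all_order all_algebra.
From mathcomp Require Import all_classical all_reals all_analysis.
From mathcomp Require Import ring lra.

Set Implicit Arguments.
Unset Strict Implicit.
Unset Printing Implicit Defensive.

Import Order.TTheory GRing.Theory Num.Theory.
Import numFieldNormedType.Exports.

Local Open Scope ring_scope.

Section G1.
Context {R : realType}.
Implicit Types (theta t : R) (u v w : 'rV[R]_3) (b : nat -> nat -> nat -> 'rV[R]_3).

(** * Coordinates and rotations about the axis *)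

Lemma vec3E u : u = vec3 (u 0 0) (u 0 1) (u 0 2%:R).
Proof.
apply/rowP => i; rewrite mxE.
by case: i => -[|[|[|//]]] hi /=; congr (u _ _); apply/val_inj.
Qed.

Lemma vec3D (a a' b b' c c' : R) :
  vec3 a b c + vec3 a' b' c' = vec3 (a + a') (b + b') (c + c').
Proof. by apply/rowP => i; rewrite !mxE; case: i => -[|[|[|//]]]. Qed.

Lemma vec3Z (k a b c : R) : k *: vec3 a b c = vec3 (k * a) (k * b) (k * c).
Proof. by apply/rowP => i; rewrite !mxE; case: i => -[|[|[|//]]]. Qed.

Lemma vec3N (a b c : R) : - vec3 a b c = vec3 (- a) (- b) (- c).
Proof. by apply/rowP => i; rewrite !mxE; case: i => -[|[|[|//]]]. Qed.

Lemma vec3_inj (a a' b b' c c' : R) :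
  vec3 a b c = vec3 a' b' c' -> [/\ a = a', b = b' & c = c'].
Proof.
move=> /rowP e; split; [have := e 0|have := e 1|have := e 2%:R];
  by rewrite !mxE.
Qed.

Lemma rotz_vec3 theta (a b c : R) : rotz theta (vec3 a b c) =
  vec3 (cos theta * a - sin theta * b) (sin theta * a + cos theta * b) c.
Proof. by rewrite /rotz !mxE. Qed.

Lemma rotz0 theta : rotz theta 0 = 0.
Proof.
rewrite /rotz !mxE !mulr0 subr0 addr0.
by apply/rowP => i; rewrite !mxE; case: i => -[|[|[|//]]].
Qed.

Lemma rotzD theta u v : rotz theta (u + v) = rotz theta u + rotz theta v.
Proof.
by rewrite (vec3E u) (vec3E v) vec3D !rotz_vec3 vec3D; congr vec3; ring.
Qed.

Lemma rotzZ theta (k : R) v : rotz theta (k *: v) = k *: rotz theta v.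
Proof. by rewrite (vec3E v) vec3Z !rotz_vec3 vec3Z; congr vec3; ring. Qed.

Lemma rotz_bezier2 theta b xi eta :
  rotz theta (bezier2 b xi eta)
  = bezier2 (fun i j k => rotz theta (b i j k)) xi eta.
Proof.
rewrite /bezier2.
do 3 (rewrite (big_morph _ (rotzD theta) (rotz0 theta)); apply: eq_bigr => ? _).
by rewrite rotzZ.
Qed.

(** * Derivatives of quadratic patches *)

Lemma bezier2E b xi eta : bezier2 b xi eta =
  (1 - xi - eta) ^+ 2 *: b 0 0 2 + eta ^+ 2 *: b 0 2 0 + xi ^+ 2 *: b 2 0 0
  + (2 * eta * (1 - xi - eta)) *: b 0 1 1 + (2 * xi * (1 - xi - eta)) *: b 1 0 1
  + (2 * xi * eta) *: b 1 1 0.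
Proof.
rewrite /bezier2 !big_ord_recl !big_ord0 /=.
do ! rewrite big_mkcond !big_ord_recl big_ord0 /=.
rewrite /bump /= !addn0 -[(1 + 1)%N]/2%N !factS fact0.
by apply/rowP => c; rewrite !mxE; field.
Qed.

(** Collecting powers of the moving parameter brings every partial derivative and diagonal tangent
    below to this form. *)
Lemma derive1_quadratic (m p : nat) (A B C : 'M[R]_(m, p)) t :
  derive1 (fun y : R => y ^+ 2 *: A + y *: B + C) t = (2 * t) *: A + B.
Proof.
have dij i j : is_derive t (1 : R)
    (fun y : R => (y ^+ 2 *: A + y *: B + C) i j) (2 * t * A i j + B i j).
  rewrite (_ : (fun y : R => _) = (fun y => y ^+ 2 * A i j + y * B i j + C i j)).
    by apply: is_derive_eq; rewrite /GRing.scale /=; ring.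
  by apply/funext => y; rewrite !mxE.
have df : derivable (fun y : R => y ^+ 2 *: A + y *: B + C) t 1.
  by apply/derivable_mxP => i j; have [] := dij i j.
rewrite derive1E derive_mx //.
by apply/matrixP => i j; rewrite !mxE; have [_ ->] := dij i j.
Qed.

Lemma partial_xi_bezier2 b xi eta : partial_xi (bezier2 b) xi eta =
  2 *: (xi *: (b 2 0 0 - b 1 0 1) + eta *: (b 1 1 0 - b 0 1 1)
        + (1 - xi - eta) *: (b 1 0 1 - b 0 0 2)).
Proof.
rewrite /partial_xi.
under eq_fun => y.
  rewrite bezier2E (_ : _ + _ = y ^+ 2 *: (b 0 0 2 + b 2 0 0 - 2 *: b 1 0 1)
    + y *: (2 *: ((1 - eta) *: (b 1 0 1 - b 0 0 2) + eta *: (b 1 1 0 - b 0 1 1)))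
    + ((1 - eta) ^+ 2 *: b 0 0 2 + eta ^+ 2 *: b 0 2 0
       + (2 * eta * (1 - eta)) *: b 0 1 1)).
    over.
  by apply/rowP => c; rewrite !mxE; ring.
by rewrite derive1_quadratic; apply/rowP => c; rewrite !mxE; ring.
Qed.

Lemma partial_eta_bezier2 b xi eta : partial_eta (bezier2 b) xi eta =
  2 *: (xi *: (b 1 1 0 - b 1 0 1) + eta *: (b 0 2 0 - b 0 1 1)
        + (1 - xi - eta) *: (b 0 1 1 - b 0 0 2)).
Proof.
rewrite /partial_eta.
under eq_fun => y.
  rewrite bezier2E (_ : _ + _ = y ^+ 2 *: (b 0 0 2 + b 0 2 0 - 2 *: b 0 1 1)
    + y *: (2 *: ((1 - xi) *: (b 0 1 1 - b 0 0 2) + xi *: (b 1 1 0 - b 1 0 1)))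
    + ((1 - xi) ^+ 2 *: b 0 0 2 + xi ^+ 2 *: b 2 0 0
       + (2 * xi * (1 - xi)) *: b 1 0 1)).
    over.
  by apply/rowP => c; rewrite !mxE; ring.
by rewrite derive1_quadratic; apply/rowP => c; rewrite !mxE; ring.
Qed.

Lemma tangent_eta0_bezier2 b t : boundary_tangent (bezier2 b) side_eta0 t =
  2 *: (t *: (b 2 0 0 - b 1 0 1) + (1 - t) *: (b 1 0 1 - b 0 0 2)).
Proof.
rewrite -[LHS]/(partial_xi (bezier2 b) t 0) partial_xi_bezier2.
by rewrite scale0r addr0 subr0.
Qed.

Lemma tangent_diag_bezier2 b t : boundary_tangent (bezier2 b) side_diag t =
  2 *: (t *: (b 2 0 0 - b 1 1 0) + (1 - t) *: (b 1 1 0 - b 0 2 0)).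
Proof.
rewrite /boundary_tangent /boundary_curve /=.
under eq_fun => y.
  rewrite bezier2E (_ : _ + _ = y ^+ 2 *: (b 0 2 0 + b 2 0 0 - 2 *: b 1 1 0)
    + y *: (2 *: (b 1 1 0 - b 0 2 0)) + b 0 2 0).
    over.
  by apply/rowP => c; rewrite !mxE; ring.
by rewrite derive1_quadratic; apply/rowP => c; rewrite !mxE; ring.
Qed.

(** * Coplanarity along a shared edge *)

(** The span of all three is already that of [u] and [v], each of rank at most 1. *)
Lemma coplanar_comb u v w (k : R) : w = v + k *: u -> coplanar u v w.
Proof.
move=> wE; rewrite /coplanar.
have sub : (u + v + w <= u + v)%MS.
  rewrite addsmx_sub submx_refl /= wE addmx_sub ?addsmxSr //.
  by rewrite (submx_trans (scalemx_sub _ (submx_refl _))) ?addsmxSl.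
apply: (leq_trans (mxrankS sub)); apply: (leq_trans (mxrank_adds_leqif _ _)).
exact: (leq_add (rank_leq_row u) (rank_leq_row v)).
Qed.

(* The last two hypotheses are the cross-boundary relation
   [cross (b') = cross b + k * tangent] read on the Bernstein coefficients. *)
Lemma bezier2_shared_edge b b' (k t : R)
    (h020 : b' 0 2 0 = b 0 0 2) (h110 : b' 1 1 0 = b 1 0 1)
    (h200 : b' 2 0 0 = b 2 0 0)
    (e0 : b 1 0 1 - b' 0 1 1 = b 0 1 1 - b 0 0 2 + k *: (b 1 0 1 - b 0 0 2))
    (e1 : b 2 0 0 - b' 1 0 1 = b 1 1 0 - b 1 0 1 + k *: (b 2 0 0 - b 1 0 1)) :
  boundary_tangent (bezier2 b') side_diag t
    = boundary_tangent (bezier2 b) side_eta0 t /\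
  cross_partial (bezier2 b') side_diag t
    = cross_partial (bezier2 b) side_eta0 t
      + k *: boundary_tangent (bezier2 b) side_eta0 t.
Proof.
rewrite tangent_diag_bezier2 tangent_eta0_bezier2 /= partial_xi_bezier2.
rewrite partial_eta_bezier2 h020 h110 h200; split=> //.
rewrite e1 e0.
by apply/rowP => c; rewrite !mxE; ring.
Qed.

(** * Boundary curves in cylindrical coordinates *)

Definition polar (rho phi zeta : R) : 'rV[R]_3 :=
  vec3 (rho * cos phi) (rho * sin phi) zeta.

Lemma rotz_polar theta rho phi zeta :
  rotz theta (polar rho phi zeta) = polar rho (theta + phi) zeta.
Proof. by rewrite rotz_vec3 /polar cosD sinD; congr vec3; ring. Qed.

Section Spline.
Context (n : nat) (r s h x z : R).
Context (hn : (3 <= n)%N) (hr0 : 0 < r) (hh : h != 0) (hx0 : 0 < x).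

Local Notation a := (pi / n%:R : R).
Local Notation ctrl := (control_point n r s h x z).
Local Notation "'rot' k" := (2 * pi * k%:R / n%:R : R) (at level 10).
Local Notation P := (rotated_patches (n := n) (bezier2 ctrl)).
Local Notation c := (Num.sqrt (1 - r ^+ 2)).

(** The apex lies on the axis, so its angle [phi] is free; it is later set to the angle of the edge
    under study. *)
Lemma control_polar theta phi :
  [/\ rotz theta (ctrl 0 0 2) = polar r (theta + a) c,
      rotz theta (ctrl 0 2 0) = polar r (theta - a) c,
      rotz theta (ctrl 2 0 0) = polar 0 phi (c + h)
    & [/\ rotz theta (ctrl 0 1 1) = polar x theta (c + z),
          rotz theta (ctrl 1 0 1) = polar s (theta + a) (c + h)
        & rotz theta (ctrl 1 1 0) = polar s (theta - a) (c + h)]].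
Proof.
by split; [| | |split]; rewrite rotz_vec3 /polar ?cosD ?sinD ?cosN ?sinN;
  congr vec3; ring.
Qed.

Lemma rotated_patchE (k : 'I_n) :
  P k = bezier2 (fun i j l => rotz (rot k) (ctrl i j l)).
Proof. by apply/funext => xi; apply/funext => eta; exact: rotz_bezier2. Qed.

(** The quadratic Bézier arc with radii [r], [s], 0 and heights [c], [c + h], [c + h] at angle
    [phi]. Both inner sides of a patch have this form, running from the base at [t = 0] to the apex
    at [t = 1]. *)
Definition meridian phi t : 'rV[R]_3 :=
  polar (r * (1 - t) ^+ 2 + 2 * s * t * (1 - t)) phi (c + h * (2 * t - t ^+ 2)).

Lemma boundary_eta0 (k : 'I_n) t :
  boundary_curve (P k) side_eta0 t = meridian (rot k + a) t.
Proof.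
rewrite /boundary_curve rotated_patchE bezier2E /=.
have [-> _ -> [_ -> _]] := control_polar (rot k) (rot k + a).
rewrite !(expr0n, mulr0, mul0r, scale0r, addr0, subr0) /=.
by rewrite !vec3Z !vec3D; congr vec3; ring.
Qed.

Lemma boundary_diag (k : 'I_n) t :
  boundary_curve (P k) side_diag t = meridian (rot k - a) t.
Proof.
rewrite /boundary_curve rotated_patchE bezier2E /=.
have [_ -> -> [_ _ ->]] := control_polar (rot k) (rot k - a).
rewrite (_ : 1 - t - (1 - t) = 0); last by ring.
rewrite !(expr0n, mulr0, mul0r, scale0r, addr0, add0r) /=.
by rewrite !vec3Z !vec3D; congr vec3; ring.
Qed.

Lemma boundary_xi0 (k : 'I_n) t : boundary_curve (P k) side_xi0 t =
  rotz (rot k) (vec3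
    (r * cos a * ((1 - t) ^+ 2 + t ^+ 2) + 2 * t * (1 - t) * x)
    (r * sin a * (1 - 2 * t)) (c + 2 * t * (1 - t) * z)).
Proof.
rewrite /boundary_curve /rotated_patches bezier2E /=; congr rotz.
rewrite !(expr0n, mulr0, mul0r, scale0r, addr0, subr0) /=.
by rewrite !vec3Z !vec3D; congr vec3; ring.
Qed.

(** * Angles between patches *)

Lemma n_gt0 : 0 < n%:R :> R.
Proof. by rewrite ltr0n (leq_trans _ hn). Qed.

Lemma a_bounds : 0 < a < pi / 2.
Proof.
have n0 := n_gt0; have p0 := pi_gt0 R.
rewrite divr_gt0 //= ltr_pM2l // ltf_pV2 ?posrE //.
by rewrite ltr_nat (leq_trans _ hn).
Qed.

Lemma cos_a_gt0 : 0 < cos a.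
Proof. by have /andP[a0 a1] := a_bounds; apply: cos_gt0_pihalf; lra. Qed.

Lemma sin_a_gt0 : 0 < sin a.
Proof. by have /andP[a0 a1] := a_bounds; apply: sin_gt0_pi; lra. Qed.

Lemma a_mul_n : a * n%:R = pi.
Proof. by rewrite divfK // gt_eqF // n_gt0. Qed.

Lemma rotE (k : nat) : rot k = 2 * (a * k%:R).
Proof. by field; rewrite gt_eqF // n_gt0. Qed.

(** For [l < k] the angle is [2 * y] with [y] strictly between 0 and pi, and cos 2y = 1 - 2 sin^2
    y. *)
Lemma cos_rotB_neq1 (k l : 'I_n) : k != l -> cos (rot k - rot l) != 1.
Proof.
wlog lk : k l / (l < k)%N => [H kl|_].
  case: (ltngtP l k) kl => [lk|kl|/val_inj->]; last by rewrite eqxx.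
    exact: H.
  by move=> lk; rewrite -cosN opprB H // eq_sym.
have /andP[a0 _] := a_bounds.
have k1 : k%:R < n%:R :> R by rewrite ltr_nat.
have l0 : 0 <= l%:R :> R by rewrite ler0n.
have kl : l%:R < k%:R :> R by rewrite ltr_nat.
have : 0 < sin (a * (k%:R - l%:R)).
  apply: sin_gt0_pi; rewrite mulr_gt0 ?subr_gt0 //= -[ltRHS]a_mul_n.
  by rewrite ltr_pM2l //; lra.
set y := a * _ => y0.
rewrite !rotE (_ : _ - _ = y + y); last by rewrite /y; ring.
have := cos2Dsin2 y; rewrite cosD; apply: contraPneq => e.
have : 0 < sin y * sin y by exact: mulr_gt0.
lra.
Qed.

(** The two signs would put the angle [rot k - rot l] within [a] of 0 modulo a full turn, but it is
    a multiple of [2 * a] that is nonzero modulo a full turn. *)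
Lemma wedge_disjoint (k l : 'I_n) : k != l ->
  0 <= sin (a + (rot k - rot l)) -> 0 <= sin (a - (rot k - rot l)) -> False.
Proof.
wlog lk : k l / (l < k)%N => [H kl|_].
  case: (ltngtP l k) kl => [lk|kl|/val_inj->]; last by rewrite eqxx.
    exact: H.
  by move=> lk sp sm; apply: (H l k); rewrite // 1?eq_sym // -(opprB (rot k)) ?opprK.
have /andP[a0 _] := a_bounds; have an := a_mul_n.
have k1 : k%:R + 1 <= n%:R :> R by rewrite natr1 ler_nat.
have l0 : 0 <= l%:R :> R by rewrite ler0n.
have kl : l%:R + 1 <= k%:R :> R by rewrite natr1 ler_nat.
rewrite !rotE => sp sm.
(* Put m = k - l. In the first case sin (a - 2am) = - sin (a(2m - 1)) < 0; in the second, a n = pi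
   gives sin (a + 2am) = - sin (a(2m + 1 - n)) < 0. *)
have [small|big] := ltP (2 * (k%:R - l%:R) - 1) (n%:R : R).
  have : 0 < sin (a * (2 * (k%:R - l%:R) - 1)).
    apply: sin_gt0_pi; rewrite mulr_gt0 //=; last lra.
    by rewrite -[ltRHS]an ltr_pM2l.
  rewrite (_ : a * _ = - (a - (2 * (a * k%:R) - 2 * (a * l%:R)))); last by ring.
  by rewrite sinN; lra.
have : 0 < sin (a * (2 * (k%:R - l%:R) + 1 - n%:R)).
  apply: sin_gt0_pi; rewrite mulr_gt0 //=; last lra.
  by rewrite -[ltRHS]an ltr_pM2l //; lra.
rewrite mulrBr an (_ : a * _ = a + (2 * (a * k%:R) - 2 * (a * l%:R))); last by ring.
by rewrite sinB sinpi cospi; lra.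
Qed.

(** * Which sides can have the same image *)

Lemma boundary_set_sub (p q : Defs.patch R) (e f : side) t :
  boundary_set p e = boundary_set q f -> 0 <= t <= 1 ->
  exists2 t', 0 <= t' <= 1 & boundary_curve p e t = boundary_curve q f t'.
Proof.
move=> pq t01.
have : boundary_set p e (boundary_curve p e t) by exists t; rewrite //= in_itv.
by rewrite pq => -[t' /=]; rewrite in_itv => /= t'01 <-; exists t'.
Qed.

(* The height is strictly monotone along a meridian arc since [h != 0]. *)
Lemma meridian_param phi psi t t' : 0 <= t <= 1 -> 0 <= t' <= 1 ->
  meridian phi t = meridian psi t' -> t = t'.
Proof.
move=> t01 t'01 /vec3_inj[_ _ /addrI/(mulfI hh) e].
(* The second factor vanishes on the unit interval only when both parameters are 1. *)
have /eqP : (t - t') * (2 - t - t') = 0 by lra.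
by rewrite mulf_eq0 => /orP[] /eqP; lra.
Qed.

(** Equal heights force [t = 0]; there the radius is [r > 0], so the direction can be read off. *)
Lemma meridian_dir phi psi t : 0 <= t <= 1 -> meridian phi 0 = meridian psi t ->
  cos phi = cos psi /\ sin phi = sin psi.
Proof.
move=> t01 e; have t0 : 0 = t by apply: meridian_param e => //; lra.
have r0 := lt0r_neq0 hr0.
move: e; rewrite -t0 => /vec3_inj[].
rewrite !mulr0 !mul0r !addr0 subr0 expr1n mulr1.
by move=> /(mulfI r0)-> /(mulfI r0)->.
Qed.

(** Applied with [y] equal to [a] or [- a], for two inner sides of the same kind: their base points
    differ by the rotation [rot k - rot l]. *)
Lemma meridian_same_side (k l : 'I_n) (y t : R) : k != l -> 0 <= t <= 1 ->
  meridian (rot k + y) 0 = meridian (rot l + y) t -> False.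
Proof.
move=> kl t01 /(meridian_dir t01)[eC eS].
have /eqP := cos_rotB_neq1 kl; apply.
rewrite (_ : _ - _ = rot k + y - (rot l + y)); last by ring.
by rewrite cosB eC eS -!expr2 cos2Dsin2.
Qed.

(** This is the first coordinate of the unrotated outer side, a Bernstein combination of the
    positive numbers [r * cos a], [x], [r * cos a]. *)
Lemma outer_x_gt0 t : 0 <= t <= 1 ->
  0 < r * cos a * ((1 - t) ^+ 2 + t ^+ 2) + 2 * t * (1 - t) * x.
Proof.
move=> /andP[t0 t1]; have rc : 0 < r * cos a by rewrite mulr_gt0 // cos_a_gt0.
have q0 : 0 <= t * (1 - t) * x by rewrite !mulr_ge0 ?(ltW hx0) ?subr_ge0.
have q1 : 0 < (1 - t) ^+ 2 + t ^+ 2 by nra.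
by have := mulr_gt0 rc q1; lra.
Qed.

(** The apex is on the axis; rotating back by [rot k] would give the outer point first coordinate
    0. *)
Lemma outer_not_meridian (k : 'I_n) phi t : 0 <= t <= 1 ->
  meridian phi 1 = boundary_curve (P k) side_xi0 t -> False.
Proof.
move=> t01; rewrite boundary_xi0 rotz_vec3 => /vec3_inj[].
have := outer_x_gt0 t01; set X := _ + _; set Y := r * _ * _ => X0.
rewrite subrr expr0n /= !mulr0 addr0 !mul0r => e1 e2 _.
have : X = (cos (rot k) ^+ 2 + sin (rot k) ^+ 2) * X by rewrite cos2Dsin2 mul1r.
have -> : (cos (rot k) ^+ 2 + sin (rot k) ^+ 2) * X =
  cos (rot k) * (cos (rot k) * X - sin (rot k) * Y)
  + sin (rot k) * (sin (rot k) * X + cos (rot k) * Y) by ring.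
by rewrite -e1 -e2; lra.
Qed.

(* Each outer side lies in the angular sector of its own patch, with its
   midpoint on the bisector. *)
Lemma outer_distinct (k l : 'I_n) t : k != l -> 0 <= t <= 1 ->
  boundary_curve (P k) side_xi0 (1 / 2) = boundary_curve (P l) side_xi0 t ->
  False.
Proof.
move=> kl t01; rewrite !boundary_xi0 !rotz_vec3.
have M0 := @outer_x_gt0 (1 / 2) ltac:(lra).
rewrite (_ : 1 - 2 * (1 / 2) = 0 :> R); last by field.
rewrite !mulr0 subr0 addr0; move: M0; set M := _ + _ => M0 /vec3_inj[].
set X := _ + 2 * t * _ * _; set Y := r * sin a * _ => eX eY _.
have cs := cos2Dsin2 (rot l).
(* In the frame of patch [l], the midpoint has radius [M] and angle [rot k - rot l]. *)
have XE : X = M * cos (rot k - rot l).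
  rewrite cosB -[LHS]mul1r -{1}cs.
  transitivity (cos (rot l) * (cos (rot l) * X - sin (rot l) * Y)
    + sin (rot l) * (sin (rot l) * X + cos (rot l) * Y)); first by ring.
  by rewrite -eX -eY; ring.
have YE : Y = M * sin (rot k - rot l).
  rewrite sinB -[LHS]mul1r -{1}cs.
  transitivity (cos (rot l) * (sin (rot l) * X + cos (rot l) * Y)
    - sin (rot l) * (cos (rot l) * X - sin (rot l) * Y)); first by ring.
  by rewrite -eX -eY; ring.
have /andP[t0 t1] := t01.
have ca := cos_a_gt0; have sa := sin_a_gt0.
have q : 0 <= 2 * (t * (1 - t) * x * sin a).
  by rewrite !mulr_ge0 ?(ltW sa) ?(ltW hx0) //; lra.
have rcs : 0 <= r * cos a * sin a by rewrite !mulr_ge0 // ltW.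
have q1 : 0 <= r * cos a * sin a * (1 - t) ^+ 2 by rewrite mulr_ge0 ?sqr_ge0.
have q2 : 0 <= r * cos a * sin a * t ^+ 2 by rewrite mulr_ge0 ?sqr_ge0.
(* Scaled by [M], the two sines become X sin a + Y cos a and X sin a - Y cos a, whose Bernstein
   coefficients are nonnegative. *)
apply: (wedge_disjoint kl).
  rewrite -(pmulr_rge0 _ M0).
  rewrite (_ : M * _ = X * sin a + Y * cos a); last by rewrite XE YE sinD; ring.
  rewrite (_ : _ + _ = 2 * (r * cos a * sin a * (1 - t) ^+ 2)
    + 2 * (t * (1 - t) * x * sin a)); last by rewrite /X /Y; ring.
  by rewrite addr_ge0 // mulr_ge0.
rewrite -(pmulr_rge0 _ M0).
rewrite (_ : M * _ = X * sin a - Y * cos a); last by rewrite XE YE sinB; ring.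
rewrite (_ : _ - _ = 2 * (r * cos a * sin a * t ^+ 2)
  + 2 * (t * (1 - t) * x * sin a)); last by rewrite /X /Y; ring.
by rewrite addr_ge0 // mulr_ge0.
Qed.

(** * Tangent planes of adjacent patches *)

Context (hsr : s != r).
Context (hx : x = (s + (r - s) * cos (2 * pi / n%:R)) / cos a).
Context (hz : z = h / (r - s) * (r - x * cos a)).

(** Adjacency is stated through cosine and sine, so the wrap from the last patch to the first is
    included. The factor is forced at the apex end, where the radial components require s + k s = 2
    s cos 2a; the base end then determines [x] and [z]. *)
Lemma adjacent_patches (k l : 'I_n) t :
  cos (rot k + a) = cos (rot l - a) -> sin (rot k + a) = sin (rot l - a) ->
  boundary_tangent (P l) side_diag t = boundary_tangent (P k) side_eta0 t /\
  cross_partial (P l) side_diag t = cross_partial (P k) side_eta0 t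
    + (2 * cos (a + a) - 1) *: boundary_tangent (P k) side_eta0 t.
Proof.
move=> eC eS; rewrite !rotated_patchE.
have ca := lt0r_neq0 cos_a_gt0.
have hx' : x * cos a = s + (r - s) * cos (a + a).
  by rewrite hx divfK //; congr (_ + _ * cos _); ring.
have rs : r - s != 0 by rewrite subr_eq0 eq_sym.
have hz' : z = h * (1 - cos (a + a)) by rewrite hz hx'; field.
have [k002 _ k200 [k011 k101 k110]] := control_polar (rot k) (rot k + a).
have [_ l020 l200 [l011 l101 l110]] := control_polar (rot l) (rot k + a).
(* All directions are expanded around the common edge direction [rot k + a]. *)
have [ck sk] : cos (rot k) = cos (rot k + a) * cos a + sin (rot k + a) * sin a /\
    sin (rot k) = sin (rot k + a) * cos a - cos (rot k + a) * sin a.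
  by rewrite -cosB -sinB addrK.
have [cl sl] : cos (rot l) = cos (rot k + a) * cos a - sin (rot k + a) * sin a /\
    sin (rot l) = sin (rot k + a) * cos a + cos (rot k + a) * sin a.
  by rewrite eC eS -cosD -sinD subrK.
have [ckm skm] :
    cos (rot k - a)
      = cos (rot k + a) * cos (a + a) + sin (rot k + a) * sin (a + a) /\
    sin (rot k - a)
      = sin (rot k + a) * cos (a + a) - cos (rot k + a) * sin (a + a).
  by rewrite -cosB -sinB addrKA.
have [clp slp] :
    cos (rot l + a)
      = cos (rot k + a) * cos (a + a) - sin (rot k + a) * sin (a + a) /\
    sin (rot l + a)
      = sin (rot k + a) * cos (a + a) + cos (rot k + a) * sin (a + a).
  by rewrite eC eS -cosD -sinD addrA subrK.
(* Multiplied by the edge direction, the equation for [x] makes the horizontal goals linear in the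
   products present. *)
have hxC := congr1 ( *%R (cos (rot k + a))) hx'.
have hxS := congr1 ( *%R (sin (rot k + a))) hx'.
apply: bezier2_shared_edge.
- by rewrite l020 k002 /polar eC eS.
- by rewrite l110 k101 /polar eC eS.
- by rewrite l200 k200.
- rewrite l011 k011 k101 k002 /polar ck sk cl sl !(vec3N, vec3D, vec3Z).
  by congr vec3; [lra | lra | rewrite hz'; ring].
- rewrite l101 k101 k110 k200 /polar ckm skm clp slp !(vec3N, vec3D, vec3Z).
  by congr vec3; ring.
Qed.

End Spline.

End G1.

Theorem mainTheorem4 (R : realType) (n : nat) (r s h x z : R)
  (hn : (3 <= n)%N) (hr0 : 0 < r) (hr1 : r < 1)
  (hs : 0 < s) (hsr : s != r) (hh : h != 0)
  (hx : x = (s + (r - s) * cos (2 * pi / n%:R)) / cos (pi / n%:R))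
  (hz : z = h / (r - s) * (r - x * cos (pi / n%:R)))
  (hx0 : 0 < x) :
  G1_continuous (rotated_patches (n := n) (bezier2 (control_point n r s h x z))).
Proof.
move=> k l e f kl E t t' /[!in_itv]/= t01 t'01.
have in0 : 0 <= (0 : R) <= 1 by lra.
have in1 : 0 <= (1 : R) <= 1 by lra.
have in2 : 0 <= (1 / 2 : R) <= 1 by lra.
(* Sample points settle every pair of sides: the base or apex of an inner side, the midpoint of an
   outer one. *)
have [u0 u001 e0] := boundary_set_sub E in0.
have [u1 u101 e1] := boundary_set_sub E in1.
have [u2 u201 e2] := boundary_set_sub E in2.
have [v1 v101 e3] := boundary_set_sub (esym E) in1.
have outer_inner (j : 'I_n) phi y : 0 <= y <= 1 -> meridian r s h phi 1 =
    boundary_curve (rotated_patches (bezier2 (control_point n r s h x z)) j)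
      side_xi0 y -> False.
  exact: outer_not_meridian.
case: e f {E} e0 e1 e2 e3 => -[] e0 e1 e2 e3.
- by case: (outer_distinct hn hr0 hx0 kl u201 e2).
- by move: e3; rewrite boundary_eta0 => /(outer_inner _ _ _ v101).
- by move: e3; rewrite boundary_diag => /(outer_inner _ _ _ v101).
- by move: e1; rewrite boundary_eta0 => /(outer_inner _ _ _ u101).
- by move: e0; rewrite !boundary_eta0 => /(meridian_same_side hn hr0 hh kl u001).
- move: e0; rewrite boundary_eta0 boundary_diag.
  move=> /(meridian_dir hr0 hh u001)[eC eS].
  (* The arcs share their orientation, so a common point has equal parameters. *)
  rewrite boundary_eta0 boundary_diag => /(meridian_param hh t01 t'01)<-.
  have [_ cross] := adjacent_patches hn hsr hx hz t eC eS.
  exact: coplanar_comb cross.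
- by move: e1; rewrite boundary_diag => /(outer_inner _ _ _ u101).
- move: e0; rewrite boundary_eta0 boundary_diag.
  move=> /(meridian_dir hr0 hh u001)[eC eS].
  rewrite boundary_eta0 boundary_diag => /(meridian_param hh t01 t'01)<-.
  have [tangent cross] := adjacent_patches hn hsr hx hz t (esym eC) (esym eS).
  (* Here patch [k] follows patch [l], so the relation is solved for the other cross derivative and
     the factor changes sign. *)
  apply: (coplanar_comb (k := 1 - 2 * cos (pi / n%:R + pi / n%:R))).
  rewrite cross tangent -addrA -scalerDl (_ : _ - 1 + _ = 0); last by ring.
  by rewrite scale0r addr0.
- by move: e0; rewrite !boundary_diag => /(meridian_same_side hn hr0 hh kl u001).
Qed.
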